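(* Let $G$ be an $n$-vertex finite simple graph with $\alpha(G)=2$. For every positive integer $\ell$ with $2\ell\leq \lceil n/2\rceil$, the graph $G$ contains a special odd model of $K^{\ell}_{\ell,\lceil n/2\rceil-\ell}$.
   Context: $\alpha(G)$ is the independence number of $G$. For integers $m,k$, $K^{m}_{m,k}$ denotes the graph obtained from the disjoint union of a complete graph $K_m$ and an independent set of $k$ vertices by adding all edges between the $K_m$ and the independent set. For a graph $H$, an $H$-model in $G$ is a collection $(T_v)_{v\in V(H)}$ of pairwise vertex-disjoint subgraphs of $G$, each a tree (branch sets), such that for every edge $uv\in E(H)$ some edge of $G$ joins $T_u$ and $T_v$. An $H$-model is odd if there is a $2$-colouring of the vertices of the branch sets such that every edge inside each tree $T_v$ is bichromatic and, for each $uv\in E(H)$, there is an edge between $T_u$ and $T_v$ whose endpoints have the same colour. An odd $H$-model is special if, for some such $2$-colouring, all branch sets that consist of a single vertex receive the same colour. *)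

(* Defs.v *)
From HB Require Import structures.
From mathcomp Require Import all_boot.

Set Implicit Arguments.
Unset Strict Implicit.
Unset Printing Implicit Defensive.

Record sgraph := SGraph {
  vertex :> finType;
  adj : rel vertex;
  adj_sym : symmetric adj;
  adj_irrefl : irreflexive adj }.

Definition independent (G : sgraph) (A : {set G}) : bool :=
  [forall x in A, forall y in A, ~~ adj x y].

Definition alpha (G : sgraph) : nat :=
  \max_(A : {set G} | independent A) #|A|.

(* The graph K^m_{m,k}: the clique is 'I_m, the independent set is 'I_k. *)
Definition clique_join_adj (m k : nat) : rel ('I_m + 'I_k) :=
  fun u v => match u, v with
  | inl i, inl j => i != j
  | inl _, inr _ => true
  | inr _, inl _ => true
  | inr _, inr _ => false
  end.

Lemma clique_join_sym m k : symmetric (@clique_join_adj m k).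
Proof. by case=> i [] j //=; rewrite eq_sym. Qed.

Lemma clique_join_irrefl m k : irreflexive (@clique_join_adj m k).
Proof. by case=> i //=; rewrite eqxx. Qed.

Definition clique_join (m k : nat) : sgraph :=
  SGraph (@clique_join_sym m k) (@clique_join_irrefl m k).

(* Subgraphs need not be induced: the edge set is part of the data. *)
Record subgraph (G : sgraph) := Subgraph {
  sub_verts : {set G};
  sub_adj : rel G;
  sub_adj_sym : symmetric sub_adj;
  sub_adj_adj : forall x y, sub_adj x y -> adj x y;
  sub_adj_verts : forall x y, sub_adj x y -> x \in sub_verts /\ y \in sub_verts }.

Definition connected_sub (G : sgraph) (S : subgraph G) : Prop :=
  sub_verts S != set0 /\
  {in sub_verts S &, forall x y, connect (sub_adj S) x y}.

(* [ucycle] also accepts the sequences [:: x; y] that traverse one edge twice;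
   the cycles of a simple graph are those with at least 3 vertices. *)
Definition acyclic_sub (G : sgraph) (S : subgraph G) : Prop :=
  forall c : seq G, ucycle (sub_adj S) c -> size c < 3.

Definition is_tree (G : sgraph) (S : subgraph G) : Prop :=
  connected_sub S /\ acyclic_sub S.

Record model (H G : sgraph) := Model {
  branch : H -> subgraph G;
  branch_tree : forall v, is_tree (branch v);
  branch_disjoint : forall u v, u != v ->
    [disjoint sub_verts (branch u) & sub_verts (branch v)];
  branch_adj : forall u v : H, adj u v ->
    exists x y, [/\ x \in sub_verts (branch u), y \in sub_verts (branch v)
                  & adj x y] }.

(* Colours of vertices outside the branch sets play no role. *)
Definition odd_colouring (H G : sgraph) (M : model H G) (c : G -> bool) : Prop :=
  (forall (v : H) (x y : G), sub_adj (branch M v) x y -> c x != c y) /\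
  (forall u v : H, adj u v ->
    exists x y, [/\ x \in sub_verts (branch M u), y \in sub_verts (branch M v),
                    adj x y & c x = c y]).

Definition singletons_monochromatic (H G : sgraph) (M : model H G)
    (c : G -> bool) : Prop :=
  forall (u v : H) (x y : G),
    sub_verts (branch M u) = [set x] -> sub_verts (branch M v) = [set y] ->
    c x = c y.

Definition special_odd_model (H G : sgraph) (M : model H G) : Prop :=
  exists c : G -> bool, odd_colouring M c /\ singletons_monochromatic M c.

(* Main.v *)
(** A seagull is an induced path on three vertices.  When no three vertices are
    independent, every other vertex is adjacent to an end of a given seagull;
    hence, colouring the middles of some disjoint seagulls black and everything
    else white, a seagull is joined by a white-white edge to every branch set
    that contains a white vertex.  It is therefore enough to find k <= l
    disjoint seagulls and a set W of other vertices with #|W| + k >= N, where N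
    is half the order of G rounded up, such that at least l - k elements of W
    are adjacent to all of W.

    Take s disjoint seagulls avoiding a vertex v, with s < l as large as
    possible, so chosen that they cover as much as possible of the clique Q of
    non-neighbours of v.  If W = (the uncovered vertices outside Q) is too
    small, at least N - 2s >= 2 vertices of Q are uncovered, and then every
    seagull meets Q in one or two vertices.  Fix y0 in Q uncovered, and say that
    x outside Q separates q in Q when x distinguishes q from y0.  A seagull with
    two vertices in Q is a separated pair (w, m) plus a third vertex m' of Q not
    separated by w.  An augmenting path for the matching formed by the pairs
    (w, m) would produce a better packing, so, as in Koenig's theorem, deleting
    the w's that are not reached by alternating paths and the m's of the reached
    ones leaves no separated pair.  The vertices outside Q that are not deleted
    are thus complete or anticomplete to K+ (the rest of Q, of size at least l):
    those complete to K+ form together with Q one candidate for W, those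
    anticomplete to K+ form a clique which, with the seagulls of the unreached
    w's, is the other candidate.  These candidates exhaust G, so one of them is
    large enough. *)

Require Import Defs.
From HB Require Import structures.
From mathcomp Require Import all_boot.
From mathcomp Require Import zify.

Set Implicit Arguments.
Unset Strict Implicit.
Unset Printing Implicit Defensive.

(** * Seagulls *)

Section Seagulls.

Variable G : sgraph.
Implicit Types (x y z : G) (S T : {set G}).

Definition seagull S :=
  [exists x, exists y, exists z,
    [&& S == [set x; y; z], adj x y, adj y z, ~~ adj x z & x != z]].

Lemma seagullP S :
  reflect (exists x y z,
             [/\ S = [set x; y; z], adj x y, adj y z, ~~ adj x z & x != z])
          (seagull S).
Proof.
apply: (iffP existsP) => [[x /existsP[y /existsP[z /and5P[/eqP ? ? ? ? ?]]]]|].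
  by exists x, y, z.
case=> x [y [z [-> xy yz xz nxz]]]; exists x; apply/existsP; exists y.
by apply/existsP; exists z; rewrite eqxx xy yz xz.
Qed.

Lemma adj_neq x y : adj x y -> x != y.
Proof. by apply: contraTneq => ->; rewrite adj_irrefl. Qed.

Lemma seagull3 x y z :
  adj x y -> adj y z -> ~~ adj x z -> x != z -> seagull [set x; y; z].
Proof. by move=> *; apply/seagullP; exists x, y, z. Qed.

Lemma card_set3 x y z : x != y -> y != z -> x != z -> #|[set x; y; z]| = 3.
Proof.
move=> xy yz xz; rewrite -setUA cardsU1 cards2 !inE negb_or.
by rewrite xy xz yz.
Qed.

Lemma card_seagull S : seagull S -> #|S| = 3.
Proof.
case/seagullP=> x [y [z [-> xy yz _ xz]]].
by apply: card_set3 => //; apply: adj_neq.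
Qed.

Definition is_clique S := {in S &, forall x y, x != y -> adj x y}.

Lemma card_seagull_clique S T : seagull S -> is_clique T -> #|S :&: T| <= 2.
Proof.
move=> sS clT; rewrite -ltnS -(card_seagull sS) proper_card //.
rewrite properEneq subsetIl andbT; apply/negP => /eqP/setIidPl sST.
case/seagullP: (sS) => x [y [z [eS _ _ /negP xz nxz]]]; apply: xz.
by apply: clT => //; apply: (subsetP sST); rewrite eS !inE eqxx ?orbT.
Qed.

(** The clique makes [a] and [b] adjacent, and exactly one of them is adjacent to [x]; that one is
    the middle of the path. *)
Lemma seagull_sep S x a b : is_clique S -> x \notin S -> a \in S -> b \in S ->
  adj x a != adj x b -> seagull [set x; a; b].
Proof.
move=> clS xS aS bS ne.
have nab : a != b by apply: contraNneq ne => ->.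
have [nxa nxb] : x != a /\ x != b.
  by split; apply: contraNneq xS => ->.
have ab := clS _ _ aS bS nab.
case xa: (adj x a) ne => /= xb; first by rewrite seagull3 //; case: adj xb.
rewrite -setUA [[set a; b]]setUC setUA seagull3 ?xa //.
  by move: xb; case: adj.
by rewrite adj_sym.
Qed.

Definition packing k (f : 'I_k -> {set G}) :=
  (forall i, seagull (f i)) /\
  (forall i j, i != j -> [disjoint f i & f j]).

(* In the eventual model the seagulls and l - re_k elements of re_C become the
   branch sets of the clique, the other elements of re_W those of the
   independent set. *)
Record realizable (l N : nat) : Prop := Realizable {
  re_k : nat;
  re_f : 'I_re_k -> {set G};
  re_C : {set G};
  re_W : {set G};
  re_packing : packing re_f;
  re_kl : re_k <= l;
  re_CW : re_C \subset re_W;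
  re_disj : forall i, [disjoint re_f i & re_W];
  re_adj : {in re_C & re_W, forall c w, c != w -> adj c w};
  re_cardC : l <= #|re_C| + re_k;
  re_cardW : N <= #|re_W| + re_k }.

Lemma clique_realizable l N S : is_clique S -> l <= N -> N <= #|S| ->
  realizable l N.
Proof.
move=> clS lN NS.
apply: (@Realizable l N 0 (fun=> set0) S S) => //; rewrite ?addn0 //.
- by split=> [[]|[]].
- by case.
- exact: leq_trans NS.
Qed.

Definition no_stable3 :=
  forall x y z, x != y -> y != z -> x != z -> [|| adj x y, adj y z | adj x z].

(** The ends of [S] are nonadjacent, so [x] is adjacent to one of them. If adjacent to both, [x]
    becomes the middle. Otherwise it becomes an end, followed by the old middle if that is a
    neighbour, and else by its neighbouring old end. *)
Lemma seagull_extend S x : no_stable3 -> seagull S -> x \notin S ->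
  exists T, [/\ seagull T, x \in T & T \subset x |: S].
Proof.
move=> alpha2 /seagullP[a [b [c [-> ab bc ac nac]]]].
rewrite !inE !negb_or => /andP[/andP[xa xb] xc].
have := alpha2 _ _ _ xa nac xc; rewrite (negPf ac) /=.
have sub p q : p \in [set a; b; c] -> q \in [set a; b; c] ->
    [set x; p; q] \subset x |: [set a; b; c].
  by move=> hp hq; rewrite !subUset !sub1set setU11 !setU1r.
have fin p q : p \in [set a; b; c] -> q \in [set a; b; c] ->
    seagull [set x; p; q] -> exists T,
      [/\ seagull T, x \in T & T \subset x |: [set a; b; c]].
  by move=> *; exists [set x; p; q]; rewrite sub // !inE eqxx.
have [ia ib ic] : [/\ a \in [set a; b; c], b \in [set a; b; c]
                    & c \in [set a; b; c]] by rewrite !inE !eqxx !orbT.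
have [ba cb] : adj b a /\ adj c b by rewrite ![_ b _]adj_sym [adj c b]adj_sym.
case hxa: (adj x a); case hxc: (adj x c) => //= _.
- apply: (fin a c) => //; rewrite -setUA setUCA setUA seagull3 //.
  by rewrite adj_sym.
- case hxb: (adj x b).
    by apply: (fin b c) => //; rewrite seagull3 // hxc.
  by apply: (fin a b) => //; rewrite seagull3 // hxb.
- case hxb: (adj x b).
    by apply: (fin b a) => //; rewrite seagull3 // hxa.
  by apply: (fin c b) => //; rewrite seagull3 // hxb.
Qed.

End Seagulls.

(** * From packings to special odd models *)

Section Models.

Variable G : sgraph.
Implicit Types (x y z : G) (S : {set G}).

Definition induced_adj S : rel G := fun x y => [&& x \in S, y \in S & adj x y].

Lemma induced_adj_sym S : symmetric (induced_adj S).
Proof. by move=> x y; rewrite /induced_adj andbCA adj_sym. Qed.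

Lemma induced_adj_adj S x y : induced_adj S x y -> adj x y.
Proof. by case/and3P. Qed.

Lemma induced_adj_verts S x y : induced_adj S x y -> x \in S /\ y \in S.
Proof. by case/and3P. Qed.

Definition induced S : subgraph G :=
  Subgraph (induced_adj_sym S) (@induced_adj_adj S) (@induced_adj_verts S).

Lemma cycle_induced_sub S c : cycle (induced_adj S) c -> {subset c <= S}.
Proof. by move=> cyc t /(next_cycle cyc) /and3P[]. Qed.

Lemma single_tree x : is_tree (induced [set x]).
Proof.
split.
  split=> /=; first by apply/set0Pn; exists x; rewrite inE.
  by move=> a b /=; rewrite !inE => /eqP-> /eqP->.
move=> c /andP[cyc uc]; have sub := cycle_induced_sub cyc.
have: size c <= size [:: x].
  by apply: uniq_leq_size => // t /sub; rewrite !inE.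
by move=> /= /leq_ltn_trans->.
Qed.

Lemma seagull_tree S : seagull S -> is_tree (induced S).
Proof.
move=> sS; have cS := card_seagull sS.
case/seagullP: sS => x [y [z [eS xy yz xz nxz]]].
have [xS yS zS] : [/\ x \in S, y \in S & z \in S].
  by rewrite eS !inE !eqxx !orbT.
split.
  split=> /=; first by apply/set0Pn; exists x.
  have toy t : t \in S -> connect (induced_adj S) t y.
    move=> tS; have [->|nty] := eqVneq t y; first exact: connect0.
    apply: connect1; rewrite /induced_adj tS yS /=.
    move: tS; rewrite eS !inE (negPf nty) orbF => /orP[] /eqP-> //.
    by rewrite adj_sym.
  move=> a b aS bS; apply: connect_trans (toy a aS) _.
  by rewrite (sym_connect_sym (@induced_adj_sym S)) toy.
move=> c /andP[cyc uc]; have sub := cycle_induced_sub cyc.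
(* A cycle of length at least three would run through all of [S], which makes the nonadjacent ends
   [x] and [z] neighbours on a triangle. *)
rewrite ltnNge; apply/negP => c3.
have eqcS : [set t in c] = S.
  apply/eqP; rewrite eqEcard cS cardsE (card_uniqP uc) c3 andbT.
  by apply/subsetP=> t; rewrite inE => /sub.
have c3' : size c = 3 by rewrite -cS -eqcS cardsE (card_uniqP uc).
have [xc zc] : x \in c /\ z \in c.
  by move: xS zS; rewrite -eqcS !inE.
case: c cyc c3' xc zc {uc sub c3 eqcS} => [|p [|q [|r []]]] //=.
rewrite andbT => /and3P[/and3P[_ _ pq] /and3P[_ _ qr] /and3P[_ _ rp]] _.
have [qp rq pr] : [/\ adj q p, adj r q & adj p r].
  by rewrite ![adj q p]adj_sym [adj r q]adj_sym [adj p r]adj_sym.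
rewrite !inE => xc zc; move: xc zc xz nxz.
by case/or3P=> /eqP-> /or3P[] /eqP->; rewrite ?pq ?qr ?rp ?qp ?rq ?pr ?eqxx.
Qed.

(** Asking [col] to hold on every singleton is what makes the model special; a seagull is too large
    to be a singleton. *)
Lemma special_model_of_sets (H : sgraph) (S : H -> {set G}) (col : G -> bool) :
  (forall u, (exists2 x, S u = [set x] & col x) \/ seagull (S u)) ->
  (forall u v, u != v -> [disjoint S u & S v]) ->
  (forall u, {in S u &, forall x y, adj x y -> col x != col y}) ->
  (forall u v : H, adj u v -> exists x y,
      [/\ x \in S u, y \in S v, adj x y & col x = col y]) ->
  exists M : model H G, special_odd_model M.
Proof.
move=> Sk Sd Sc Sa.
have tS u : is_tree (induced (S u)).
  by case: (Sk u) => [[x -> _]|]; [apply: single_tree | apply: seagull_tree].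
have aS (u v : H) : adj u v -> exists x y,
    [/\ x \in sub_verts (induced (S u)), y \in sub_verts (induced (S v))
      & adj x y].
  by case/Sa=> x [y [? ? ? _]]; exists x, y.
exists (@Model H G (fun u => induced (S u)) tS Sd aS), col; split.
  split; last exact: Sa.
  by move=> u x y /= /and3P[xu yu xy]; exact: (Sc u x y xu yu xy).
have single u x : S u = [set x] -> col x.
  move=> eSu; case: (Sk u) => [[y]|]; rewrite eSu.
    by move/set1_inj->.
  by move/card_seagull; rewrite cards1.
by move=> u v x y /= /single -> /single ->.
Qed.

Lemma special_model_of_realizable l N (x0 : G) : no_stable3 G ->
  l <= N -> realizable G l N ->
  exists M : model (clique_join l (N - l)) G, special_odd_model M.
Proof.
move=> alpha2 lN [k f C W [sg dj] kl CW dW adW cC cW].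
pose isT i (p : G * G * G) :=
  [/\ f i = [set p.1.1; p.1.2; p.2], adj p.1.1 p.1.2, adj p.1.2 p.2,
      ~~ adj p.1.1 p.2 & p.1.1 != p.2].
have /fin_all_exists[t ht] i : exists p, isT i p.
  by case/seagullP: (sg i) => x [y [z ?]]; exists (x, y, z).
have tin i : [/\ (t i).1.1 \in f i, (t i).1.2 \in f i & (t i).2 \in f i].
  by case: (ht i) => -> *; rewrite !inE !eqxx !orbT.
have fdisj i j x : x \in f i -> x \in f j -> i = j.
  move=> xi xj; apply/eqP/negPn/negP => /dj /disjointFr /(_ xi).
  by rewrite xj.
(* [true] is white; only the middles of the seagulls are black. *)
pose col x := [forall i, x != (t i).1.2].
have colmid i : col (t i).1.2 = false.
  by apply/negbTE/forallPn; exists i; rewrite eqxx.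
have colf i x : x \in f i -> x != (t i).1.2 -> col x.
  move=> xi nx; apply/forallP => j; have [<- //|nij] := eqVneq i j.
  by apply: contraNneq nij => e; apply/eqP/(fdisj _ _ x) => //; rewrite e; case: (tin j).
have colend i : col (t i).1.1 /\ col (t i).2.
  case: (ht i) (tin i) => _ xy yz _ _ [? _ ?].
  split; apply: (colf i) => //; first exact: adj_neq.
  by rewrite eq_sym; exact: adj_neq.
have colW w : w \in W -> col w.
  move=> wW; apply/forallP=> i; apply: contraTneq wW => ->.
  by case: (tin i) => _ mi _; rewrite (disjointFr (dW i) mi).
(* The list [L] of [W] starts with [l - k] elements of [C], so the clique vertices left over by the
   seagulls all receive elements of [C]. *)
pose C1 := take (l - k) (enum C).
pose L := C1 ++ [seq w <- enum W | w \notin C1].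
have C1C : {subset C1 <= C} by move=> x /mem_take; rewrite mem_enum.
have sC1 : size C1 = l - k.
  by rewrite size_takel // -cardE leq_subLR addnC.
have uC1 : uniq C1 by rewrite take_uniq ?enum_uniq.
have uL : uniq L.
  rewrite cat_uniq uC1 filter_uniq ?enum_uniq // andbT /=.
  by apply/hasPn=> x; rewrite mem_filter => /andP[].
have LW : L =i W.
  move=> x; rewrite mem_cat mem_filter mem_enum.
  case xC1: (x \in C1) => //=.
  by rewrite (subsetP CW) // C1C.
have sL : size L = #|W| by rewrite -(card_uniqP uL) (eq_card LW).
pose idx (u : clique_join l (N - l)) : nat :=
  match u with inl i => i | inr j => l + j end.
have idx_lt u : idx u < N by case: u => i /=; have := ltn_ord i; lia.
have idx_inj u v : idx u = idx v -> u = v.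
  case: u v => i [] j /= e; have := ltn_ord i; have := ltn_ord j; try lia.
    by move=> _ _; congr inl; apply: val_inj.
  by move=> _ _; congr inr; apply: val_inj => /=; lia.
(* The default [x0] is never returned: [idx u < N <= #|W| + k] keeps the position within [L]. *)
pose S u : {set G} := if insub (idx u) is Some i then f i
                      else [set nth x0 L (idx u - k)].
pose kind u := (exists2 i : 'I_k, S u = f i & idx u = i) \/
  exists2 w, S u = [set w] &
     [/\ w \in W, k <= idx u, w = nth x0 L (idx u - k) & idx u < l -> w \in C].
have Sk u : kind u.
  rewrite /kind /S; case: insubP => [i _ ei|]; first by left; exists i.
  rewrite -leqNgt => ku; right; exists (nth x0 L (idx u - k)) => //.
  have := idx_lt u => lu; split => //.
    by rewrite -LW mem_nth // sL; lia.
  by move=> ul; rewrite nth_cat sC1 ltn_sub2r ?C1C ?mem_nth ?sC1 //; lia.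
have Sd u v : u != v -> [disjoint S u & S v].
  move=> nuv; case: (Sk u) => [[i -> ei]|[w -> [wW ku ew _]]];
    case: (Sk v) => [[j -> ej]|[w' -> [w'W kv ew' _]]].
  - apply: dj; apply: contraNneq nuv => eij; apply/eqP/idx_inj.
    by rewrite ei ej eij.
  - by rewrite disjoint_sym disjoints1; rewrite (disjointFl (dW i)).
  - by rewrite disjoints1; rewrite (disjointFl (dW j)).
  - rewrite disjoints1 inE; apply: contraNneq nuv; rewrite ew ew' => /eqP.
    have [lu lv] := (idx_lt u, idx_lt v).
    rewrite nth_uniq ?sL //; [|lia|lia] => /eqP e.
    by apply/eqP/idx_inj; lia.
have white u : exists2 x, x \in S u & col x.
  case: (Sk u) => [[i -> _]|[w -> [/colW cw _ _ _]]].
    by exists (t i).2; [case: (tin i) | case: (colend i)].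
  by exists w; rewrite ?inE.
have dom i x : x \notin f i -> col x -> exists y, [/\ y \in f i, adj y x & col y].
  case: (tin i) (colend i) (ht i) => ai _ ci [ca cc] [_ _ _ nac nneq] xi cx.
  have [nax nxc] : (t i).1.1 != x /\ x != (t i).2.
    by split; [apply: contraNneq xi => <- | apply: contraNneq xi => ->].
  case/or3P: (alpha2 _ _ _ nax nxc nneq) => [ax|xc|ac].
  - by exists (t i).1.1.
  - by exists (t i).2; rewrite adj_sym.
  - by rewrite ac in nac.
have Sa u v : u != v -> idx u < l -> exists x y,
    [/\ x \in S u, y \in S v, adj x y & col x = col y].
  move=> nuv ul; have duv := Sd _ _ nuv.
  case: (Sk u) => [[i eSu _]|[w eSu [wW _ _ /(_ ul) wC]]].
    have [y yv cy] := white v; have [|x [xi xy cx]] := dom i y _ cy.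
      by rewrite -eSu (disjointFl duv).
    by exists x, y; rewrite eSu cx cy.
  have cw := colW _ wW; have wu : w \in S u by rewrite eSu inE.
  case: (Sk v) => [[j eSv _]|[w' eSv [w'W _ _ _]]].
    have [|x [xj xw cx]] := dom j w _ cw.
      by rewrite -eSv (disjointFr duv).
    by exists w, x; rewrite wu eSv xj adj_sym xw cx cw.
  exists w, w'; rewrite wu eSv inE eqxx cw colW //; split=> //.
  apply: adW => //; apply: contraTneq wu => ->.
  by rewrite (disjointFl duv) // eSv inE.
apply: (special_model_of_sets (S := S) (col := col)) => //.
- move=> u; case: (Sk u) => [[i -> _]|[w -> [wW _ _ _]]]; first by right.
  by left; exists w; rewrite ?colW.
- move=> u; case: (Sk u) => [[i -> _]|[w -> _]] x y; last first.
    by rewrite !inE => /eqP-> /eqP->; rewrite adj_irrefl.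
  case: (ht i) (colend i) => -> _ _ nac _ [ca cc]; rewrite !inE.
  move=> xf yf xy; move: xf yf xy.
  case/orP=> [/orP[]|] /eqP-> /orP[/orP[]|] /eqP->;
    by rewrite ?adj_irrefl ?ca ?cc ?colmid // ?[adj _ (t i).1.1]adj_sym
               ?(negPf nac).
- case=> [i|j] [i'|j'] //= adj_uv.
  + apply: (Sa (inl i) (inl i')) (ltn_ord i); apply: contraTneq adj_uv => -[->].
    by rewrite eqxx.
  + exact: (Sa (inl i) (inr j')) (ltn_ord i).
  + have [//|x [y [? ? ? ?]]] := Sa (inl i') (inr j) _ (ltn_ord i').
    by exists y, x; rewrite adj_sym.
Qed.

End Models.

(** * Packings of maximum coverage *)

(** The vertex [y] has the same adjacencies to the rest of [S] as [q], so it takes the place of [q]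
    on the path, be it an end or the middle. *)
Lemma seagull_swap (G : sgraph) (S : {set G}) (q y : G) :
  seagull S -> q \in S -> y \notin S ->
  {in S, forall x, x != q -> adj x y = adj x q} -> seagull (y |: S :\ q).
Proof.
case/seagullP=> a [b [c [-> ab bc nac ac]]] qS yS eqa.
have [ia ib ic] : [/\ a \in [set a; b; c], b \in [set a; b; c]
                    & c \in [set a; b; c]] by rewrite !inE !eqxx !orbT.
have [nab nbc] := (adj_neq ab, adj_neq bc).
have [nba ncb nca] : [/\ b != a, c != b & c != a] by split; rewrite eq_sym.
have [ya yb yc] : [/\ y != a, y != b & y != c].
  by move: yS; rewrite !inE !negb_or => /andP[/andP[]].
have fin p r t : adj p r -> adj r t -> ~~ adj p t -> p != t ->
    [set p; r; t] =i y |: [set a; b; c] :\ q -> seagull (y |: [set a; b; c] :\ q).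
  by move=> pr rt pt npt /setP <-; apply: seagull3.
move: qS; rewrite !inE => /orP[/orP[]|] /eqP eq_q; subst q.
- apply: (fin y b c); rewrite ?[adj y _]adj_sym ?eqa // 1?adj_sym //.
  move=> x; rewrite !inE; have [->|nxa] := eqVneq x a; last by rewrite orbA.
  by rewrite ![a == _]eq_sym (negPf ya) (negPf nba) (negPf nca).
- apply: (fin a y c); rewrite ?[adj y _]adj_sym ?eqa // 1?adj_sym //.
  move=> x; rewrite !inE; have [->|nxb] := eqVneq x b; last first.
    by case: (x == a) (x == y) (x == c) => [] [] [].
  by rewrite ![b == _]eq_sym (negPf yb) (negPf nab) (negPf ncb).
- apply: (fin a b y); rewrite ?eqa //; first by rewrite eq_sym.
  move=> x; rewrite !inE; have [->|nxc] := eqVneq x c; last first.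
    by case: (x == a) (x == y) (x == b) => [] [] [].
  by rewrite ![c == _]eq_sym (negPf yc) (negPf ac) (negPf nbc).
Qed.

Lemma card_bigcup_disjoint (T I : finType) (F : I -> {set T}) :
  (forall i j, i != j -> [disjoint F i & F j]) ->
  #|\bigcup_i F i| = \sum_i #|F i|.
Proof.
move=> dF; rewrite -sum1_card (partition_disjoint_bigcup _ _ dF).
by apply: eq_bigr => i _; rewrite sum1_card.
Qed.

Section MaxCoverage.

Variables (G : sgraph) (s : nat) (f : 'I_s -> {set G}) (v : G) (Q : {set G}).
Hypotheses (alpha2 : no_stable3 G) (clQ : is_clique Q) (vQ : v \notin Q).
Hypotheses (pf : packing f) (vf : forall i, v \notin f i).
Hypothesis fmax : forall g : 'I_s -> {set G}, packing g ->
  (forall i, v \notin g i) ->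
  \sum_i #|g i :&: Q| <= \sum_i #|f i :&: Q|.

Definition uncovered := [set y in Q | [forall i, y \notin f i]].

Lemma uncoveredP y :
  reflect (y \in Q /\ forall i, y \notin f i) (y \in uncovered).
Proof. by rewrite inE; apply: (iffP andP) => -[yQ /forallP]. Qed.

Lemma packing_inj i j x : x \in f i -> x \in f j -> i = j.
Proof.
move=> xi xj; apply/eqP/negPn/negP => /(pf.2) /disjointFr /(_ xi).
by rewrite xj.
Qed.

Lemma replace_one i T : seagull T -> v \notin T ->
  (forall j, j != i -> [disjoint T & f j]) -> #|T :&: Q| <= #|f i :&: Q|.
Proof.
move=> sT vT dT; pose g j := if j == i then T else f j.
have pg : packing g.
  split=> [j|j k njk]; rewrite /g; first by case: ifP => // _; apply: pf.1.
  case: eqVneq => [ej|nj]; case: eqVneq => [ek|nk].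
  - by rewrite ej ek eqxx in njk.
  - exact: dT.
  - by rewrite disjoint_sym dT.
  - exact: pf.2.
have vg j : v \notin g j by rewrite /g; case: ifP.
have := fmax pg vg; rewrite (bigD1 i) //= [X in _ <= X](bigD1 i) //=.
rewrite (eq_bigr (fun j => #|f j :&: Q|)) => [|j nj]; last by rewrite /g (negPf nj).
by rewrite leq_add2r /g eqxx.
Qed.

(** If [f i] missed [Q], a seagull through [y] inside [y |: f i] could replace it and cover more of
    [Q]. *)
Lemma packing_meets y i : y \in uncovered -> 0 < #|f i :&: Q|.
Proof.
case/uncoveredP=> yQ yf.
have [T [sT yT sub]] := seagull_extend alpha2 (pf.1 i) (yf i).
apply: leq_trans (replace_one sT _ _).
- by apply/card_gt0P; exists y; rewrite inE yT.
- apply/negP => /(subsetP sub); rewrite !inE (negPf (vf i)) orbF => /eqP vy.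
  by move: vQ; rewrite vy yQ.
move=> j nji; apply/pred0Pn => -[x /= /andP[/(subsetP sub)]].
rewrite !inE => /orP[/eqP-> xj|xi xj]; first by rewrite (negPf (yf j)) in xj.
by rewrite (packing_inj xi xj) eqxx in nji.
Qed.

Lemma card_meets y i : y \in uncovered ->
  #|f i :&: Q| = 1 \/ #|f i :&: Q| = 2.
Proof.
move/(packing_meets i); have := card_seagull_clique (pf.1 i) clQ.
by case: #|_| => [|[|[|]]]; auto.
Qed.

(* Vertices outside Q that are available once the seagull f t is discarded. *)
Definition free_for t o :=
  [&& o \notin Q, o != v & [forall (j | j != t), o \notin f j]].

Lemma free_forP t o :
  reflect [/\ o \notin Q, o != v & forall j, j != t -> o \notin f j]
          (free_for t o).
Proof.
apply: (iffP and3P) => -[? ? H]; split=> //; first exact/forall_inP.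
by apply/forall_inP.
Qed.

(** Otherwise [o], [a] and [b] form a seagull with two vertices in [Q], which could replace [f t],
    which has only one. *)
Lemma free_uniform t o a b : #|f t :&: Q| = 1 -> free_for t o ->
  a \in uncovered :|: (f t :&: Q) -> b \in uncovered :|: (f t :&: Q) ->
  adj o a = adj o b.
Proof.
move=> t1 /free_forP[oQ ov of_] aK bK; apply/eqP/negPn/negP => ne.
have inQ x : x \in uncovered :|: (f t :&: Q) ->
    x \in Q /\ forall j, j != t -> x \notin f j.
  case/setUP=> [/uncoveredP[xQ xf]|/setIP[xt xQ]]; split=> // j nj.
  by apply: contra nj => /(packing_inj xt) ->.
have [[aQ af] [bQ bf]] := (inQ a aK, inQ b bK).
have := @replace_one t _ (seagull_sep clQ oQ aQ bQ ne).
have nab : a != b by apply: contraNneq ne => ->.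
have -> : [set o; a; b] :&: Q = [set a; b].
  apply/setP=> x; rewrite !inE.
  have [->|nxo] := eqVneq x o.
    rewrite (negPf oQ) andbF; apply/esym/negbTE; rewrite negb_or.
    by apply/andP; split; apply: contraNneq oQ => ->.
  have [->|] := eqVneq x a; first by rewrite aQ.
  by have [->|] := eqVneq x b; first by rewrite bQ.
rewrite t1 cards2 nab => H; suff: 1 < 1 by []; apply: H.
  rewrite !inE !negb_or eq_sym ov /=.
  by apply/andP; split; apply: contraNneq vQ => ->.
move=> j nj; apply/pred0Pn => -[x /= /andP[]]; rewrite !inE.
by case/orP=> [/orP[]|] /eqP-> xj; move: xj; apply/negP; auto.
Qed.

(** * Separated pairs and augmenting alternating paths *)

Variable y0 : G.
Hypothesis y0B : y0 \in uncovered.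

Definition sep x q := adj x q != adj x y0.

Definition labels (w m m' : 'I_s -> G) := forall i,
  [/\ m' i \in f i :&: Q,
      #|f i :&: Q| = 1 -> f i :&: Q = [set m' i]
    & #|f i :&: Q| = 2 ->
      [/\ f i = [set w i; m i; m' i], w i \notin Q,
          m i \in Q, m i != m' i & sep (w i) (m i) && ~~ sep (w i) (m' i)]].

(** When a seagull has two vertices in the clique [Q], its third vertex is adjacent to exactly one
    of them, so it separates exactly one of them from [y0]. *)
Lemma labels_exist : exists w m m', labels w m m'.
Proof.
pose isL i (p : G * G * G) :=
  [/\ p.2 \in f i :&: Q,
      #|f i :&: Q| = 1 -> f i :&: Q = [set p.2]
    & #|f i :&: Q| = 2 ->
      [/\ f i = [set p.1.1; p.1.2; p.2], p.1.1 \notin Q,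
          p.1.2 \in Q, p.1.2 != p.2 & sep p.1.1 p.1.2 && ~~ sep p.1.1 p.2]].
have /fin_all_exists[p hp] i : exists p, isL i p.
  case: (card_meets i y0B) => [/eqP/cards1P[q eq]|c2].
    by exists (q, q, q); split; rewrite /= eq ?inE ?cards1.
  have : #|f i :\: Q| = 1.
    by have := cardsID Q (f i); rewrite (card_seagull (pf.1 i)) c2; lia.
  move/eqP/cards1P=> [x ex].
  have [xi xQ] : x \in f i /\ x \notin Q.
    by have : x \in f i :\: Q; [rewrite ex inE | case/setDP].
  move/eqP/cards2P: (c2) => [a [b [nab eab]]].
  have [[ai aQ] [bi bQ]] : (a \in f i /\ a \in Q) /\ (b \in f i /\ b \in Q).
    by split; apply/setIP; rewrite eab !inE eqxx ?orbT.
  have efi : f i = [set x; a; b] by rewrite -setUA -eab -ex setUC setID.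
  (* The nonadjacent ends cannot both lie in the clique [Q], so [x] is an end: it is adjacent to the
     middle but not to the other end. *)
  have sab : adj x a != adj x b.
    apply/negP => /eqP exab.
    case/seagullP: (pf.1 i) => p [q [r [epqr pq qr npr dpr]]].
    have [[ip iq] ir] : (p \in f i /\ q \in f i) /\ r \in f i.
      by rewrite epqr !inE !eqxx !orbT.
    have tri y z : y \in f i -> z \in f i -> y != z ->
        [\/ y = x, z = x | adj y z].
      rewrite efi !inE => hy hz nyz.
      case: (eqVneq y x) => [->|nyx]; first by constructor 1.
      case: (eqVneq z x) => [->|nzx]; first by constructor 2.
      constructor 3; apply: clQ => //.
        by move: hy; rewrite (negPf nyx) /= => /orP[] /eqP->.
      by move: hz; rewrite (negPf nzx) /= => /orP[] /eqP->.
    have adjx y z : y \in f i -> z \in f i -> y != x -> z != x ->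
        adj x y = adj x z.
      rewrite efi !inE => + + nyx nzx; rewrite (negPf nyx) (negPf nzx) /=.
      by case/orP=> /eqP-> /orP[] /eqP->.
    case: (tri p r ip ir dpr) => [px|rx|pr]; last by rewrite pr in npr.
      have nqx : q != x by rewrite -px eq_sym adj_neq.
      have nrx : r != x by rewrite -px eq_sym.
      by rewrite px in pq npr; rewrite -(adjx q r) ?pq // in npr.
    have nqx : q != x by rewrite -rx adj_neq.
    have npx : p != x by rewrite -rx.
    by rewrite rx adj_sym in qr; rewrite rx adj_sym -(adjx q p) ?qr // in npr.
  have mk m m' : [set m; m'] = [set a; b] -> m != m' -> m \in Q -> m' \in f i :&: Q ->
      adj x m != adj x y0 -> adj x m' = adj x y0 -> exists p, isL i p.
    move=> e nmm mQ mi sm sm'; exists (x, m, m'); split; rewrite /= ?c2 // => _.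
    by split; rewrite /sep ?sm ?sm' ?eqxx // efi -!setUA e.
  case ea: (adj x a == adj x y0).
    apply: (mk b a) => //; first by rewrite setUC.
    - by rewrite eq_sym.
    - by rewrite inE ai.
    - by rewrite -(eqP ea) eq_sym.
    - exact/eqP.
  apply: (mk a b) => //; rewrite ?inE ?bi ?ea //.
  by move: sab ea; case: adj; case: adj; case: adj.
by exists (fun i => (p i).1.1), (fun i => (p i).1.2), (fun i => (p i).2).
Qed.

Variable y1 : G.
Hypotheses (y1B : y1 \in uncovered) (y01 : y0 != y1).

Variables w m m' : 'I_s -> G.
Hypothesis lab : labels w m m'.

(* Alternating paths: they start at the discarded seagull t, represented by o,
   and then run through the seagulls having two vertices in Q. *)
Definition root t o i := if i == t then o else w i.
Definition step t o : rel 'I_s :=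
  fun i j => (#|f j :&: Q| == 2) && sep (root t o i) (m j).

(* Otherwise an alternating path from t to z is augmenting: along it, each
   vertex root t o i gives up m i for the m of the next seagull, the last one
   takes q, and the third vertices stay put, except that y0 replaces q if q was
   one of them.  The seagull t is sacrificed for {o, tau t, fill t}. *)
Lemma reach_nonsep t o z q : #|f t :&: Q| = 1 -> free_for t o ->
  connect (step t o) t z -> (q \in uncovered \/ exists i, q = m' i) ->
  ~~ sep (root t o z) q.
Proof.
move=> t1 fo /connectP[p0 pth0 ez] qK; apply/negP => sepq.
rewrite {z}ez in sepq.
case/shortenP: pth0 sepq => p pth up _ sepq {p0}.
set c := t :: p in up.
(* These are the seagulls with two vertices in [Q] after the exchange: [t] joins those that had two
   already. *)
pose ty2 i := (i == t) || (#|f i :&: Q| == 2).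
(* Closing the path into a cycle lets [next] move everything one step. *)
pose mu j := if j == t then q else m j.
pose tau i := mu (next c i).
have nt i : #|f i :&: Q| == 2 -> i == t = false.
  by move=> c2; apply: contraTF c2 => /eqP->; rewrite t1.
have c_ty2 i : i \in c -> ty2 i.
  rewrite inE /ty2; case: eqVneq => //= _ ip.
  move/(pathP t): pth => /(_ (index i p)); rewrite index_mem => /(_ ip).
  by rewrite nth_index // => /andP[].
have nxt i : i \notin c -> next c i = i by rewrite next_nth => /negPf->.
have ty2_nxt i : ty2 i -> ty2 (next c i).
  case ic: (i \in c); last by rewrite nxt ?ic.
  by move=> _; apply: c_ty2; rewrite mem_next.
have sep_tau i : ty2 i -> sep (root t o i) (tau i).
  case ic: (i \in c) => ti; last first.
    have it : i == t = false by move: ic; rewrite inE => /norP[/negPf].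
    rewrite /tau nxt ?ic // /mu /root it; move: ti; rewrite /ty2 it => /eqP c2.
    by case: (lab i) => _ _ /(_ c2)[_ _ _ _ /andP[]].
  have cyc : cycle (fun i j => sep (root t o i) (mu j)) c.
    rewrite /= rcons_path /mu eqxx sepq andbT.
    by apply: sub_path pth => a b /andP[/nt ->].
  exact: (next_cycle cyc ic).
have mi i : m' i \in f i by case: (lab i) => /setIP[].
have mQ i : m' i \in Q by case: (lab i) => /setIP[].
have m_in i : #|f i :&: Q| == 2 -> [/\ m i \in f i, m i \in Q & m i != m' i].
  by case: (lab i) => _ _ H /eqP/H[-> _ ? ? _]; rewrite !inE eqxx orbT.
have KQ x : (x \in uncovered \/ exists i, x = m' i) -> x \in Q.
  by case=> [/uncoveredP[]//|[i ->]].
have K_m x j : (x \in uncovered \/ exists i, x = m' i) ->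
    #|f j :&: Q| == 2 -> x != m j.
  move=> xK /m_in[mj _ nm]; apply: contraTneq mj; case: xK.
    by case/uncoveredP=> _ xf <-.
  case=> i -> e; apply/negP => mij; rewrite -e in nm mij.
  by rewrite (packing_inj mij (mi i)) eqxx in nm.
(* If [q] is some [m' i], then [y0] may be needed to replace it, so [t] receives [y1]. If [q] is
   uncovered, it might be [y1], whereas it differs from [y0] because it is separated. *)
pose fill i := if i == t then (if q \in uncovered then y0 else y1)
               else if m' i == q then y0 else m' i.
have fillK i : fill i \in uncovered \/ exists j, fill i = m' j.
  rewrite /fill; case: ifP => _; first by case: ifP; left.
  by case: (m' i == q); [left | right; exists i].
have fillB i : i != t -> fill i = m' i \/ fill i = y0 /\ m' i = q.
  by rewrite /fill => /negPf->; case: eqVneq; [right | left].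
have m'B i : m' i \notin uncovered.
  by apply/negP => /uncoveredP[_ /(_ i)]; rewrite mi.
have m'_inj i j : m' i = m' j -> i = j.
  by move=> e; apply: (packing_inj (mi i)); rewrite e.
have sepy0 x : ~~ sep x y0 by rewrite /sep eqxx.
have qy0 : q != y0 by apply: contraTneq sepq => ->.
have fill_q i : fill i != q.
  rewrite /fill; case: ifP => _.
    by case: ifP => [_|/negbT qB]; [rewrite eq_sym | apply: contraNneq qB => <-].
  by case: (eqVneq (m' i) q) => // _; rewrite eq_sym.
have fill_t i : i != t -> fill i != fill t.
  move=> it; rewrite {2}/fill eqxx; case: (fillB i it) => [->|[-> eq]].
    by apply: contraNneq (m'B i) => ->; case: ifP.
  by rewrite -eq (negPf (m'B i)).
have fill_inj i j : fill i = fill j -> i = j.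
  case: (eqVneq i t) => [->|it]; case: (eqVneq j t) => [->|jt] // /eqP.
  - by rewrite eq_sym (negPf (fill_t j jt)).
  - by rewrite (negPf (fill_t i it)).
  case: (fillB i it) (fillB j jt) => [->|[-> ei]] [->|[-> ej]] /eqP e.
  - exact: m'_inj.
  - by move: (m'B i); rewrite e y0B.
  - by move: (m'B j); rewrite -e y0B.
  - by apply: m'_inj; rewrite ei.
have muE j : ty2 j -> (j = t /\ mu j = q) \/ (#|f j :&: Q| == 2 /\ mu j = m j).
  by rewrite /ty2 /mu; case: eqVneq => [->|_] /=; [left | right].
have tauQ i : ty2 i -> tau i \in Q.
  move/ty2_nxt/muE; rewrite -/(tau i) => -[[_ ->]|[/m_in[_ mQ' _] ->]] //.
  exact: KQ.
have tau_inj i j : ty2 i -> ty2 j -> tau i = tau j -> i = j.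
  move=> /ty2_nxt hi /ty2_nxt hj e; apply: (can_inj (prev_next up)).
  move: hi hj e => /muE + /muE; rewrite /tau.
  case=> [[-> ->]|[c2 ->]] [[-> ->]|[c2' ->]] // e.
  - by move: (K_m q _ qK c2'); rewrite e eqxx.
  - by move: (K_m q _ qK c2); rewrite -e eqxx.
  - have [mi1 _ _] := m_in _ c2; have [mi2 _ _] := m_in _ c2'.
    by rewrite e in mi1; apply: packing_inj mi1 mi2.
have tau_fill i j : ty2 i -> tau i != fill j.
  move/ty2_nxt/muE; rewrite -/(tau i) => -[[_ ->]|[c2 ->]].
    by rewrite eq_sym.
  by rewrite eq_sym K_m.
pose out i := if i == t then [set o] else f i :\: Q.
pose qp i := if ty2 i then [set tau i; fill i] else [set fill i].
pose g i := out i :|: qp i.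
have qpQ i : qp i \subset Q.
  apply/subsetP => x; rewrite /qp; case: ifP => [ti|_]; rewrite !inE.
    by case/orP=> /eqP->; [apply: tauQ | apply: KQ].
  by move/eqP->; apply: KQ.
have /free_forP[oQ ov of_] := fo.
have outQ i : [disjoint out i & Q].
  rewrite /out; case: ifP => _; first by rewrite disjoints1.
  by apply/pred0P => x; rewrite /= !inE; case: (x \in Q); rewrite ?andbF.
have out_disj i j : i != j -> [disjoint out i & out j].
  move=> nij; rewrite /out; case: eqVneq => [ei|it]; case: eqVneq => [ej|jt].
  - by rewrite ei ej eqxx in nij.
  - by rewrite disjoints1 inE (negPf (of_ j jt)) andbF.
  - by rewrite disjoint_sym disjoints1 inE (negPf (of_ i it)) andbF.
  - apply/pred0P => x; rewrite /= !inE; apply/negbTE/negP.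
    case/andP=> /andP[_ xi] /andP[_ xj].
    by rewrite (packing_inj xi xj) eqxx in nij.
have qp_disj i j x : x \in qp i -> x \in qp j -> i = j.
  rewrite /qp; case: ifP => ti; case: ifP => tj; rewrite !inE.
  - case/orP=> /eqP-> /orP[] /eqP e.
    + exact: tau_inj e.
    + by move: (tau_fill i j ti); rewrite e eqxx.
    + by move: (tau_fill j i tj); rewrite -e eqxx.
    + exact: fill_inj.
  - case/orP=> /eqP-> /eqP e; last exact: fill_inj.
    by move: (tau_fill i j ti); rewrite e eqxx.
  - move/eqP=> -> /orP[] /eqP e; last exact: fill_inj.
    by move: (tau_fill j i tj); rewrite -e eqxx.
  - by move/eqP=> -> /eqP; apply: fill_inj.
have gQ i : g i :&: Q = qp i.
  rewrite /g setIUl (setIidPl (qpQ i)).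
  by move: (outQ i); rewrite -setI_eq0 => /eqP->; rewrite set0U.
have vg i : v \notin g i.
  rewrite /g inE negb_or; apply/andP; split.
    rewrite /out; case: ifP => _; first by rewrite inE eq_sym.
    by rewrite inE (negPf (vf i)) andbF.
  by apply: contra vQ; apply: (subsetP (qpQ i)).
have card_qp i : #|qp i| = (ty2 i).+1.
  by rewrite /qp; case: ifP => ti; rewrite ?cards1 // cards2 tau_fill.
have pg : packing g.
  split=> [i|i j nij]; last first.
    apply/pred0P => x /=; apply/negbTE/negP; rewrite /g !inE.
    case/andP=> /orP[xi|xi] /orP[xj|xj].
    - by rewrite (disjointFr (out_disj i j nij) xi) in xj.
    - by move: (subsetP (qpQ j) x xj); rewrite (disjointFr (outQ i) xi).
    - by move: (subsetP (qpQ i) x xi); rewrite (disjointFr (outQ j) xj).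
    - by rewrite (qp_disj _ _ _ xi xj) eqxx in nij.
  case ti: (ty2 i); last first.
    move/negbT: ti; rewrite /ty2 negb_or => /andP[it n2].
    have c1 : #|f i :&: Q| = 1.
      by case: (card_meets i y0B) n2 => // ->.
    have [_ /(_ c1) e1 _] := lab i.
    (* A seagull with one vertex in [Q] changes only if that vertex is [q]. Then [y0] can replace it
       by [free_uniform], applied to this seagull and its own outside vertices. *)
    have -> : g i = fill i |: f i :\ m' i.
      rewrite /g /out /qp /ty2 (negPf it) (negPf n2) setUC; congr (_ :|: _).
      by rewrite -e1 setDIr setDv set0U.
    case: (fillB i it) => [->|[-> _]]; first by rewrite setD1K // pf.1.
    apply: seagull_swap; rewrite ?pf.1 //; first by case/uncoveredP: y0B.
    move=> x xi nx; apply: (free_uniform (t := i));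
      rewrite // ?in_setU ?in_setI ?y0B ?mi ?mQ ?orbT //.
    apply/free_forP; split=> [||j nji].
    - apply: contra nx => xQ; have : x \in f i :&: Q by rewrite inE xi.
      by rewrite e1 inE.
    - by apply: contraTneq xi => ->.
    - by apply: contra nji => /(packing_inj xi) ->.
  have -> : g i = [set root t o i; tau i; fill i].
    rewrite /g /qp ti /out /root setUA; case: ifP => // it.
    congr (_ :|: _ :|: _); move: ti; rewrite /ty2 it /= => /eqP c2.
    have [/setIP[_ m'Q] _ /(_ c2)[-> wQ mQ' _ _]] := lab i.
    apply/setP => x; rewrite !inE.
    case: (eqVneq x (w i)) => [->|nx]; first by rewrite wQ.
    case: eqVneq => [->|_]; first by rewrite mQ'.
    by case: eqVneq => [->|_]; rewrite ?m'Q // andbF.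
  have rQ : root t o i \notin Q.
    rewrite /root; case: ifP => // it; move: ti; rewrite /ty2 it /= => /eqP c2.
    by have [_ _ /(_ c2)[_ ? _ _ _]] := lab i.
  apply: (seagull_sep clQ rQ); rewrite ?tauQ // ?KQ //.
  (* The root separates [tau i] from [y0] but not [fill i], so it distinguishes the two. *)
  suff -> : adj (root t o i) (fill i) = adj (root t o i) y0 by exact: sep_tau.
  rewrite /root; case: eqVneq => [->|it].
    apply: (free_uniform t1 fo); rewrite in_setU ?y0B // /fill eqxx.
    by case: ifP; rewrite ?y0B ?y1B.
  case: (fillB i it) => [->|[-> _] //].
  move: ti; rewrite /ty2 (negPf it) /= => /eqP c2.
  by have [_ _ /(_ c2)[_ _ _ _ /andP[_ /negPn/eqP]]] := lab i.
(* The place [t] gains one vertex of [Q] and no other place loses any, against maximality. *)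
have := fmax pg vg; rewrite leqNgt => /negP; apply.
rewrite (bigD1 t) //= [X in _ < X](bigD1 t) //= -addSn leq_add //.
  by rewrite t1 gQ card_qp /ty2 eqxx.
apply: leq_sum => i it; rewrite gQ card_qp /ty2 (negPf it) /=.
by case: (card_meets i y0B) => ->.
Qed.

(** * Deletion of separated pairs in the manner of Koenig *)

Definition reached i := [exists t, exists o,
  [&& #|f t :&: Q| == 1, free_for t o & connect (step t o) t i]].

Lemma card_coverage : #|Q| = #|uncovered| + \sum_i #|f i :&: Q|.
Proof.
have dfQ i j : i != j -> [disjoint f i :&: Q & f j :&: Q].
  move=> nij; apply/pred0P => x; rewrite /= !inE; apply/negbTE/negP.
  case/andP=> /andP[xi _] /andP[xj _].
  by rewrite (packing_inj xi xj) eqxx in nij.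
rewrite -(card_bigcup_disjoint dfQ) -cardsUI; set I := _ :&: _; have -> : I = set0.
  apply/setP=> x; rewrite in_setI in_set0; apply/negbTE/negP.
  by case/andP=> /uncoveredP[_ xf] /bigcupP[i _ /setIP[/(negP (xf i))]].
rewrite cards0 addn0; congr #|pred_of_set _|; apply/setP => x.
rewrite in_setU; apply/idP/orP => [xQ|]; last first.
  by case=> [/uncoveredP[]|/bigcupP[i _ /setIP[]]].
case: (boolP (x \in uncovered)) => [|xU]; first by left.
right; apply/bigcupP; move: xU; rewrite inE xQ /= => /forallPn[i].
by rewrite negbK => xi; exists i; rewrite ?inE ?xi.
Qed.

Lemma sum_coverage :
  \sum_i #|f i :&: Q| = s + #|[set i | #|f i :&: Q| == 2]|.
Proof.
transitivity (\sum_(i < s) (1 + (#|f i :&: Q| == 2))).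
  by apply: eq_bigr => i _; case: (card_meets i y0B) => ->.
rewrite big_split /= sum1_card card_ord -sum1dep_card [in RHS]big_mkcond /=.
by congr (_ + _); apply: eq_bigr => i _; case: eqP.
Qed.

Definition Kplus := Q :\: [set m i | i in [set i | (#|f i :&: Q| == 2) && reached i]].
Definition unreached := [set i | (#|f i :&: Q| == 2) && ~~ reached i].
Definition outsiders := ~: Q :\: [set w i | i in unreached].

(** Each seagull contributes one vertex to [Q], or two; only for those with two may a vertex be
    deleted, and then at most one. *)
Lemma card_Kplus : #|uncovered| + s <= #|Kplus|.
Proof.
have := cardsID [set m i | i in [set i | (#|f i :&: Q| == 2) && reached i]] Q.
rewrite -/Kplus card_coverage sum_coverage; set A := [set i | _ && _].
set I := _ :&: _; have : #|I| <= #|[set i | #|f i :&: Q| == 2]|.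
  apply: leq_trans (subset_leq_card (subsetIr _ _)) _.
  apply: leq_trans (leq_imset_card _ _) _; apply: subset_leq_card.
  by apply/subsetP=> i; rewrite !inE => /andP[].
lia.
Qed.

Hypothesis vQ_adj : {in Q, forall x, ~~ adj v x}.

(** Apart from [v], which has no neighbour in [Q], every outsider is the root at the end of an
    alternating path. If [q] is uncovered or some [m' i], [reach_nonsep] applies; the remaining case
    is [q = m j]. *)
Lemma outsiders_uniform t0 x q : #|f t0 :&: Q| = 1 ->
  x \in outsiders -> q \in Kplus -> adj x q = adj x y0.
Proof.
move=> t1; rewrite in_setD in_setC => /andP[xw xQ] /setDP[qQ qm].
have y0Q : y0 \in Q by case/uncoveredP: y0B.
case: (eqVneq x v) => [->|xv].
  by rewrite (negPf (vQ_adj qQ)) (negPf (vQ_adj y0Q)).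
have ord2 i := card_meets i y0B.
(* A vertex in no seagull is free for [t0], and one in a seagull with a single vertex in [Q] is free
   for that seagull; both give paths of length zero. Otherwise [x] is [w i] with [i] reached. *)
have [t [o [z [tt fo cz ->]]]] : exists t o z, [/\ #|f t :&: Q| = 1, free_for t o,
    connect (step t o) t z & x = root t o z].
  case: (pickP (fun i => x \in f i)) => [i xi|xf]; last first.
    exists t0, x, t0; rewrite /root eqxx; split=> //.
    by apply/free_forP; split=> // j _; rewrite xf.
  case: (ord2 i) => ci.
    exists i, x, i; rewrite /root eqxx; split=> //.
    apply/free_forP; split=> // j nj; apply: contra nj.
    by move/(packing_inj xi) => ->.
  have [/setIP[_ m'Q] _ /(_ ci)[ei wQ mQ _ _]] := lab i.
  have ex : x = w i.
    move: xi xQ; rewrite ei !inE => /orP[/orP[]|] /eqP-> //.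
      by rewrite mQ.
    by rewrite m'Q.
  have : reached i.
    apply: contraNT xw => nr; apply/imsetP; exists i => //.
    by rewrite inE ci nr.
  case/existsP=> t /existsP[o /and3P[/eqP tt fo ct]].
  exists t, o, i; split=> //; rewrite /root; case: eqVneq => // eit.
  by rewrite eit tt in ci.
apply/eqP; rewrite -[_ == _]negbK -/(sep _ _).
have [|qK] := boolP ((q \in uncovered) || [exists i, q == m' i]).
  move=> qK; apply: (reach_nonsep tt fo cz).
  by case/orP: qK => [|/existsP[i /eqP]]; [left | right; exists i].
move: qK; rewrite negb_or => /andP[qU /existsPn qm'].
move: qU; rewrite inE qQ /= => /forallPn[j]; rewrite negbK => qj.
case: (ord2 j) => cj.
  have [_ /(_ cj) e _] := lab j; have : q \in f j :&: Q by rewrite inE qj.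
  by rewrite e inE (negPf (qm' j)).
have [_ _ /(_ cj)[ej wQ _ _ _]] := lab j.
have eq : q = m j.
  move: qj; rewrite ej !inE (negPf (qm' j)) orbF => /orP[] /eqP // eqw.
  by rewrite -eqw qQ in wQ.
(* If [x] separated [m j], the path would extend to [j], so [m j] would have been deleted from
   [Kplus]. *)
apply: contra qm => sepq; apply/imsetP; exists j => //.
rewrite inE cj eqxx; apply/existsP; exists t; apply/existsP; exists o.
rewrite tt eqxx fo; apply: connect_trans cz _; apply: connect1.
by rewrite /step cj eqxx -eq.
Qed.

Lemma max_coverage_realizable t0 l N : #|f t0 :&: Q| = 1 -> s <= l -> l <= N ->
  N.*2 <= #|G|.+1 -> l <= #|uncovered| + s -> realizable G l N.
Proof.
move=> t1 sl lN Nn lb.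
have unif x q : x \in outsiders -> q \in Kplus -> adj x q = adj x y0.
  exact: outsiders_uniform t1.
have y0Q : y0 \in Q by case/uncoveredP: y0B.
pose Xc := [set x in outsiders | adj x y0].
pose Xa := [set x in outsiders | ~~ adj x y0].
have cardV : #|G| <= #|Q :|: Xc| + #|Xa| + #|unreached|.
  rewrite -cardsT;
  apply: leq_trans (_ : #|(Q :|: Xc :|: Xa) :|: [set w i | i in unreached]| <= _).
    apply: subset_leq_card; apply/subsetP => x _.
    rewrite !in_setU; case: (boolP (x \in Q)) => //= xQ.
    case: (boolP (x \in _ @: _)) => xw; first by rewrite orbT.
    have xo : x \in outsiders by rewrite in_setD in_setC xw xQ.
    by rewrite [x \in Xc]in_set [x \in Xa]in_set xo orbF; case: adj.
  have [cU cI] := (leq_card_setU (Q :|: Xc :|: Xa) [set w i | i in unreached],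
                   leq_card_setU (Q :|: Xc) Xa).
  by apply: leq_trans cU.1 _; apply: leq_add (leq_imset_card _ _); apply: cI.1.
have [NW|WN] := leqP N #|Q :|: Xc|.
  apply: (@Realizable G l N 0 (fun=> set0) Kplus (Q :|: Xc)); rewrite ?addn0 //.
  - by split=> [[]|[]].
  - by apply: subset_trans (subsetUl _ _); apply: subsetDl.
  - by case.
  - move=> a b aK; rewrite in_setU => /orP[bQ|].
      by apply: clQ => //; case/setDP: aK.
    by rewrite in_set => /andP[bX by0] _; rewrite adj_sym (unif _ _ bX aK).
  - exact: leq_trans lb card_Kplus.
have Us : #|unreached| <= s by rewrite -[X in _ <= X]card_ord max_card.
(* No vertex of [Xa] is adjacent to [y0], so [Xa] is a clique. For the sizes, [#|G| >= 2N - 1] and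
   [#|Q :|: Xc| <= N - 1] leave at least [N] for [Xa] and [unreached] together. *)
apply: (@Realizable G l N #|unreached| (fun i => f (enum_val i)) Xa Xa) => //.
- split=> [i|i j nij]; first exact: pf.1.
  by apply: pf.2; rewrite (inj_eq enum_val_inj).
- exact: leq_trans sl.
- move=> i; have iD := enum_valP i; move: (enum_val i) iD => {}i iD.
  apply/pred0P => x /=; apply/negbTE/negP => /andP[xi]; rewrite in_set => /andP[].
  rewrite in_setD in_setC => /andP[xw xQ] _; case/negP: xw.
  apply/imsetP; exists i => //; move: iD; rewrite inE => /andP[/eqP ci _].
  have [/setIP[_ m'Q] _ /(_ ci)[ei wQ mQ _ _]] := lab i.
  move: xi xQ; rewrite ei !inE => /orP[/orP[]|] /eqP-> //.
    by rewrite mQ.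
  by rewrite m'Q.
- move=> a b; rewrite [a \in Xa]in_set [b \in Xa]in_set => /andP[aX ay] /andP[bX by_] nab.
  have [na nb] : a != y0 /\ b != y0.
    by split; [move: aX | move: bX]; rewrite in_setD in_setC => /andP[_];
      apply: contraNneq => ->.
  by have := alpha2 nab nb na; rewrite (negPf ay) (negPf by_) !orbF.
- lia.
- lia.
Qed.

End MaxCoverage.

(** * The main theorem *)

Lemma packing_bounded_max (G : sgraph) k : exists2 s, s <= k &
  (exists f : 'I_s -> {set G}, packing f) /\
  (s < k -> ~ exists f : 'I_s.+1 -> {set G}, packing f).
Proof.
pose P k := [exists f : {ffun 'I_k -> {set G}},
  [forall i, seagull (f i)] &&
  [forall i, forall j, (i != j) ==> [disjoint f i & f j]]].
have PP j : reflect (exists f : 'I_j -> {set G}, packing f) (P j).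
  apply: (iffP existsP) => [[f /andP[/forallP sf /forallP df]]|[f [sf df]]].
    by exists f; split=> // a b; move/forallP: (df a) => /(_ b)/implyP.
  exists (finfun f); apply/andP; split; apply/forallP=> a; rewrite ?ffunE //.
  by apply/forallP=> b; rewrite !ffunE; apply/implyP; apply: df.
elim: k => [|k [s sk [ps ns]]].
  by exists 0 => //; split=> //; exists (fun=> set0); split=> [[]|[]].
have [sk'|sk'] := ltnP s k.
  by exists s; [exact: leqW | split=> // _; exact: ns].
case: (PP s.+1) => [p|np]; last by exists s; [exact: leqW | split].
by exists s.+1; [lia | split=> //; lia].
Qed.

Lemma packing_max_coverage (G : sgraph) s (f0 : 'I_s -> {set G}) v (Q : {set G}) :
  packing f0 -> (forall i, v \notin f0 i) ->
  exists f : 'I_s -> {set G}, [/\ packing f, forall i, v \notin f i &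
    forall g : 'I_s -> {set G}, packing g -> (forall i, v \notin g i) ->
      \sum_i #|g i :&: Q| <= \sum_i #|f i :&: Q|].
Proof.
pose P (f : {ffun 'I_s -> {set G}}) := [&& [forall i, seagull (f i)],
  [forall i, forall j, (i != j) ==> [disjoint f i & f j]] &
  [forall i, v \notin f i]].
have PP (f : 'I_s -> {set G}) : packing f -> (forall i, v \notin f i) ->
    P (finfun f).
  case=> sf df vf; apply/and3P; split; apply/forallP => i; rewrite ?ffunE //.
  by apply/forallP=> j; rewrite !ffunE; apply/implyP; apply: df.
move=> pf0 vf0; have P0 := PP f0 pf0 vf0.
pose F (f : {ffun 'I_s -> {set G}}) := \sum_i #|f i :&: Q|.
case: (arg_maxnP F P0) => f /and3P[/forallP sf /forallP df /forallP vf] fm.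
exists f; split=> //.
  by split=> // a b; move/forallP: (df a) => /(_ b)/implyP.
move=> g pg vg; have := fm _ (PP g pg vg); apply: leq_trans.
by rewrite /F leq_eqVlt; apply/orP; left; apply/eqP/eq_bigr => i _; rewrite ffunE.
Qed.

Lemma no_stable3_realizable (G : sgraph) l N : no_stable3 G -> 0 < l ->
  l.*2 <= N -> N.*2 <= #|G|.+1 -> realizable G l N.
Proof.
move=> alpha2 l0 lN Nn.
(* Stopping at [l - 1] seagulls leaves room for [v] as one more clique branch set, and gives
   [N - 2s >= 2]. *)
have [s sl [[f0 pf0] ns]] := packing_bounded_max G l.-1.
have card_cover (f : 'I_s -> {set G}) : packing f -> #|\bigcup_i f i| = 3 * s.
  move=> pf; rewrite (card_bigcup_disjoint pf.2).
  rewrite (eq_bigr (fun=> 3)) => [|i _]; last exact: card_seagull (pf.1 i).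
  by rewrite sum_nat_const card_ord mulnC.
have [v vf0] : exists v, v \notin \bigcup_i f0 i.
  apply/existsP; rewrite -negb_forall; apply/negP => /forallP all_in.
  have : #|G| <= #|\bigcup_i f0 i|.
    by rewrite -cardsT subset_leq_card //; apply/subsetP.
  rewrite card_cover //; lia.
pose Q := [set x | (x != v) && ~~ adj v x].
have vf0' i : v \notin f0 i.
  by apply: contra vf0 => vi; apply/bigcupP; exists i.
have [f [pf vf fmax]] := packing_max_coverage Q pf0 vf0'.
have clQ : is_clique Q.
  move=> x y; rewrite !inE => /andP[xv nx] /andP[yv ny] xy.
  have := alpha2 x v y xv; rewrite eq_sym => /(_ yv xy).
  by rewrite [adj x v]adj_sym (negPf nx) (negPf ny).
have vQ : v \notin Q by rewrite inE eqxx.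
have lN' : l <= N by lia.
pose R := ~: \bigcup_i f i.
have cR : #|R| + 3 * s = #|G|.
  by rewrite -(card_cover f pf) /R addnC cardsC.
have eB : uncovered f Q = R :&: Q.
  apply/setP=> x; rewrite in_setI in_setC; apply/uncoveredP/andP.
    case=> xQ xf; split=> //; apply/negP => /bigcupP[i _].
    by rewrite (negPf (xf i)).
  case=> xf xQ; split=> // i; apply: contra xf => xi.
  by apply/bigcupP; exists i.
have vR : v \in R by rewrite inE; apply/negP => /bigcupP[i _]; apply/negP.
have [big|small] := leqP N (#|R :\: Q| + s).
  have vW w : w \in R :\: Q -> v != w -> adj v w.
    by rewrite !inE [v == w]eq_sym => /andP[nq _] wv; move: nq; rewrite wv negbK.
  have dW i : [disjoint f i & R :\: Q].
    apply/pred0P=> x /=; rewrite !inE; apply/negbTE/negP.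
    case/andP=> xi /andP[_ /negP]; apply; apply/bigcupP; by exists i.
  have vRQ : v \in R :\: Q by rewrite in_setD vR vQ.
  (* With [l - 1] seagulls, [v] alone completes the clique part. With fewer, two nonadjacent
     vertices of [R :\: Q] would form with [v] a further seagull, so [R :\: Q] is a clique. *)
  have [sl'|ls] := ltnP s l.-1; last first.
    apply: (@Realizable G l N s f [set v] (R :\: Q)) => //; try lia.
    - by rewrite sub1set.
    - by move=> c w; rewrite inE => /eqP->; apply: vW.
    - by rewrite cards1; lia.
  apply: (@Realizable G l N s f (R :\: Q) (R :\: Q)) => //; try lia.
  move=> a b aR bR nab; case: (eqVneq v a) => [ea|va].
    by rewrite -ea vW // ea.
  case: (eqVneq v b) => [vb|vb]; first by rewrite adj_sym -vb vW // vb eq_sym.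
  apply/negPn/negP => nadj; case: (ns sl').
  have sT : seagull [set a; v; b] by apply: seagull3 => //; [rewrite adj_sym|]; exact: vW.
  have dT i : [disjoint f i & [set a; v; b]].
    apply/pred0P=> x /=; rewrite !inE; apply/negbTE/negP => /andP[xi].
    case/orP=> [/orP[]|] /eqP e; rewrite {}e in xi.
    - by rewrite (disjointFr (dW i) xi) in aR.
    - by rewrite (disjointFr (dW i) xi) in vRQ.
    - by rewrite (disjointFr (dW i) xi) in bR.
  exists (fun i => if unlift ord0 i is Some j then f j else [set a; v; b]).
  split=> [i|i j]; first by case: unliftP => [k _|_] //; apply: pf.1.
  case: unliftP => [k ->|->]; case: unliftP => [k' ->|->] //.
  - by rewrite (inj_eq lift_inj); apply: pf.2.
  - by rewrite disjoint_sym => _; apply: dT.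
have cB : #|uncovered f Q| + #|R :\: Q| = #|R| by rewrite eB cardsID.
(* This subtracts [#|R :\: Q| <= N - 1 - s] from [#|R| >= 2N - 1 - 3s]. *)
have b2 : N <= #|uncovered f Q| + 2 * s by lia.
have b1 : 1 < #|uncovered f Q| by lia.
have [y0 [y1 [y0B y1B y01]]] : exists y0 y1,
    [/\ y0 \in uncovered f Q, y1 \in uncovered f Q & y0 != y1].
  by case/card_gt1P: b1 => y0 [y1 [? ? ?]]; exists y0, y1.
(* Alternating paths need a seagull with one vertex in [Q] to start from. If there is none, [Q] has
   [#|uncovered f Q| + 2s >= N] vertices and suffices by itself. *)
have [t1|no1] := pickP (fun t => #|f t :&: Q| == 1).
  move=> /eqP ft1.
  have [w [m [m' lab]]] := labels_exist alpha2 clQ vQ pf vf fmax y0B.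
  apply: (max_coverage_realizable alpha2 clQ vQ pf vf fmax y0B y1B y01
           lab _ ft1) => //; try lia.
  by move=> x; rewrite inE => /andP[].
apply: (clique_realizable clQ) => //.
rewrite (card_coverage Q pf) (eq_bigr (fun=> 2)).
  by rewrite sum_nat_const card_ord; lia.
move=> i _; have := card_meets alpha2 clQ vQ pf vf fmax i y0B.
by case=> // /eqP; rewrite no1.
Qed.

(* MathComp; [uphalf #|G|] is the ceiling of #|G| / 2. *)
Theorem theorem2p5 (G : sgraph) (hG : alpha G = 2) (l : nat) (hl : 0 < l)
    (hln : 2 * l <= uphalf #|G|) :
  exists M : model (clique_join l (uphalf #|G| - l)) G, special_odd_model M.
Proof.
have alpha2 : no_stable3 G.
  move=> x y z xy yz xz; apply/negPn/negP; rewrite !negb_or => /and3P[nxy nyz nxz].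
  have ind : independent [set x; y; z].
    apply/forall_inP => a ai; apply/forall_inP => b bi.
    move: ai bi; rewrite !inE.
    by case/orP=> [/orP[]|] /eqP-> /orP[/orP[]|] /eqP->; rewrite ?adj_irrefl // adj_sym.
  have := leq_bigmax_cond (F := fun A : {set G} => #|A|) _ ind.
  by rewrite -/(alpha G) hG card_set3.
have [x0 _] : exists x0 : G, x0 \in [set: G].
  by apply/set0Pn; rewrite -card_gt0 cardsT; case: #|G| hln => //; lia.
apply: special_model_of_realizable => //; first by lia.
by apply: no_stable3_realizable => //; lia.
Qed.
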